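(* Let $\mathbf{A}\in\mathbb{H}^{m\times n}$ and $\mathbf{B}\in\mathbb{H}^{s\times n}$, and let $\mathbf{X}_{LS}=(x_{ij})\in\mathbb{H}^{s\times m}$ be the minimum norm least squares solution of the matrix equation $\mathbf{X}\mathbf{A}=\mathbf{B}$ (unknown $\mathbf{X}\in\mathbb{H}^{s\times m}$). Put $\check{\mathbf{B}}:=\mathbf{B}\mathbf{A}^{*}\in\mathbb{H}^{s\times m}$ and let $\check{\mathbf{b}}_{i.}$ denote the $i$th row of $\check{\mathbf{B}}$. (i) If $\operatorname{rank}\mathbf{A}=r\le n<m$ (with $r\ge 1$), then for all $i=1,\dots,s$ and $j=1,\dots,m$, $$x_{ij}=\frac{\sum_{\alpha\in I_{r,m}\{j\}}\operatorname{rdet}_j\left(\left((\mathbf{A}\mathbf{A}^{*})_{j.}(\check{\mathbf{b}}_{i.})\right)_{\alpha}^{\alpha}\right)}{\sum_{\alpha\in I_{r,m}}\left|(\mathbf{A}\mathbf{A}^{*})_{\alpha}^{\alpha}\right|}.$$ (ii) If $\operatorname{rank}\mathbf{A}=m$, then for all $i=1,\dots,s$ and $j=1,\dots,m$, $$x_{ij}=\frac{\operatorname{rdet}_j\left((\mathbf{A}\mathbf{A}^{*})_{j.}(\check{\mathbf{b}}_{i.})\right)}{\det(\mathbf{A}\mathbf{A}^{*})}.$$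
   Context: $\mathbb{H}$ is the skew field of real (Hamilton) quaternions, $\mathbb{H}^{m\times n}$ the set of $m\times n$ quaternion matrices, $\mathbf{A}^{*}$ the conjugate transpose of $\mathbf{A}$, $\|\cdot\|$ the Frobenius norm. The rank is the usual rank of a quaternion matrix (dimension of the right column space). Minimum norm least squares solution: let $H_L=\{\mathbf{X}\in\mathbb{H}^{s\times m}: \|\mathbf{X}\mathbf{A}-\mathbf{B}\|=\min\}$ be the set of minimizers of $\|\mathbf{X}\mathbf{A}-\mathbf{B}\|$ over $\mathbb{H}^{s\times m}$ (the least squares solutions). $\mathbf{X}_{LS}$ is the element of $H_L$ of smallest Frobenius norm. Column and row determinants. Let $\mathbf{M}=(m_{ij})\in\mathbb{H}^{n\times n}$ and let $S_n$ be the symmetric group on $\{1,\dots,n\}$. All permutations are written as products of disjoint cycles, with fixed points included as cycles of length one, and $r$ denotes the number of cycles. The $i$th row determinant is $$\operatorname{rdet}_i\mathbf{M}=\sum_{\sigma\in S_n}(-1)^{n-r}m_{i\,i_{k_1}}m_{i_{k_1}i_{k_1+1}}\cdots m_{i_{k_1+l_1}\,i}\cdots m_{i_{k_r}i_{k_r+1}}\cdots m_{i_{k_r+l_r}i_{k_r}},$$ where $\sigma=(i\,i_{k_1}i_{k_1+1}\dots i_{k_1+l_1})(i_{k_2}i_{k_2+1}\dots i_{k_2+l_2})\cdots(i_{k_r}i_{k_r+1}\dots i_{k_r+l_r})$ is written so that $i$ opens the first cycle from the left, $i_{k_2}<i_{k_3}<\dots<i_{k_r}$, and $i_{k_t}<i_{k_t+u}$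 for all $t=2,\dots,r$, $u=1,\dots,l_t$. (If $i$ is a fixed point of $\sigma$, the first cycle contributes $m_{ii}$.) The $j$th column determinant is $$\operatorname{cdet}_j\mathbf{M}=\sum_{\tau\in S_n}(-1)^{n-r}m_{j_{k_r}j_{k_r+l_r}}\cdots m_{j_{k_r+1}j_{k_r}}\cdots m_{j\,j_{k_1+l_1}}\cdots m_{j_{k_1+1}j_{k_1}}m_{j_{k_1}j},$$ where $\tau=(j_{k_r+l_r}\dots j_{k_r+1}j_{k_r})\cdots(j_{k_2+l_2}\dots j_{k_2+1}j_{k_2})(j_{k_1+l_1}\dots j_{k_1+1}j_{k_1}j)$ is written so that $j$ opens the first cycle from the right, $j_{k_2}<j_{k_3}<\dots<j_{k_r}$, and $j_{k_t}<j_{k_t+u}$ for all $t=2,\dots,r$, $u=1,\dots,l_t$. (If $j$ is a fixed point of $\tau$, the first cycle contributes $m_{jj}$.) For Hermitian $\mathbf{M}$ all the $\operatorname{rdet}_i\mathbf{M}$ and $\operatorname{cdet}_i\mathbf{M}$ coincide and are real (known fact); the common value is denoted $\det\mathbf{M}$. Notation. $\mathbf{M}_{j.}(\mathbf{c})$ is the matrix obtained from $\mathbf{M}$ by replacing its $j$th row by the row $\mathbf{c}$. For an index set $\alpha$, $\mathbf{M}_\alpha^\alpha$ is the principal submatrix with rows and columns indexed by $\alpha$; for Hermitian $\mathbf{M}$, $|\mathbf{M}_\alpha^\alpha|:=\det(\mathbf{M}_\alpha^\alpha)$. $I_{r,m}$ is the set of all strictly increasing sequences of $r$ integers from $\{1,\dots,m\}$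 (identified with $r$-element subsets), and $I_{r,m}\{j\}=\{\alpha\in I_{r,m}: j\in\alpha\}$. In $\operatorname{rdet}_j(\cdot)_\alpha^\alpha$ with $j\in\alpha$, the rows and columns of the submatrix keep their original labels from $\alpha$, so that $\operatorname{rdet}_j$ is the row determinant along the row coming from the $j$th row of the full matrix. *)

(* Defs.v *)
From HB Require Import structures.
From mathcomp Require Import all_boot all_order all_fingroup all_algebra ring lra.
From mathcomp Require Import classical_sets reals.

Set Implicit Arguments.
Unset Strict Implicit.
Unset Printing Implicit Defensive.

Import Order.TTheory GRing.Theory Num.Theory.
Local Open Scope classical_set_scope.
Local Open Scope ring_scope.

(* [Quat a b c d] is a + b i + c j + d k. *)
Record quat (R : Type) : Type := Quat { qr : R; qi : R; qj : R; qk : R }.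

Definition tuple_of_quat (R : Type) (q : quat R) : R * R * R * R :=
  (qr q, qi q, qj q, qk q).
Definition quat_of_tuple (R : Type) (t : R * R * R * R) : quat R :=
  let: (a, b, c, d) := t in Quat a b c d.

Lemma tuple_of_quatK (R : Type) :
  cancel (@tuple_of_quat R) (@quat_of_tuple R).
Proof. by case. Qed.

HB.instance Definition _ (R : eqType) :=
  Equality.copy (quat R) (can_type (@tuple_of_quatK R)).
HB.instance Definition _ (R : choiceType) :=
  Choice.copy (quat R) (can_type (@tuple_of_quatK R)).

Section QuatRing.
Variable R : realFieldType.
Implicit Types p q : quat R.

Definition addq p q :=
  Quat (qr p + qr q) (qi p + qi q) (qj p + qj q) (qk p + qk q).
Definition oppq p := Quat (- qr p) (- qi p) (- qj p) (- qk p).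
Definition mulq p q :=
  Quat (qr p * qr q - qi p * qi q - qj p * qj q - qk p * qk q)
       (qr p * qi q + qi p * qr q + qj p * qk q - qk p * qj q)
       (qr p * qj q - qi p * qk q + qj p * qr q + qk p * qi q)
       (qr p * qk q + qi p * qj q - qj p * qi q + qk p * qr q).

Definition conjq p := Quat (qr p) (- qi p) (- qj p) (- qk p).

(* The squared modulus |p|^2. *)
Definition normq2 p : R := qr p ^+ 2 + qi p ^+ 2 + qj p ^+ 2 + qk p ^+ 2.

Definition invq p :=
  Quat (qr p / normq2 p) (- qi p / normq2 p)
       (- qj p / normq2 p) (- qk p / normq2 p).

Fact addqA : associative addq.
Proof. by move=> [????] [????] [????]; rewrite /addq /= !addrA. Qed.

Fact addqC : commutative addq.
Proof. by move=> [????] [????]; congr Quat; rewrite /= addrC. Qed.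

Fact add0q : left_id (Quat 0 0 0 0) addq.
Proof. by move=> [????]; rewrite /addq /= !add0r. Qed.

Fact addNq : left_inverse (Quat 0 0 0 0) oppq addq.
Proof. by move=> [????]; rewrite /addq /= !addNr. Qed.

HB.instance Definition _ :=
  GRing.isZmodule.Build (quat R) addqA addqC add0q addNq.

Fact mulqA : associative mulq.
Proof. by move=> [????] [????] [????]; congr Quat => /=; ring. Qed.

Fact mul1q : left_id (Quat 1 0 0 0) mulq.
Proof. by move=> [????]; congr Quat => /=; ring. Qed.

Fact mulq1 : right_id (Quat 1 0 0 0) mulq.
Proof. by move=> [????]; congr Quat => /=; ring. Qed.

Fact mulqDl : left_distributive mulq +%R.
Proof. by move=> [????] [????] [????]; congr Quat => /=; ring. Qed.

Fact mulqDr : right_distributive mulq +%R.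
Proof. by move=> [????] [????] [????]; congr Quat => /=; ring. Qed.

Fact oneq_neq0 : Quat 1 0 0 0 != 0 :> quat R.
Proof. by apply/eqP => -[/eqP]; rewrite oner_eq0. Qed.

HB.instance Definition _ :=
  GRing.Zmodule_isNzRing.Build (quat R) mulqA mul1q mulq1 mulqDl mulqDr
    oneq_neq0.

Lemma normq2_eq0 p : (normq2 p == 0) = (p == 0).
Proof.
apply/eqP/eqP => [|->]; last by rewrite /normq2 /= expr0n /= !addr0.
case: p => a b c d; rewrite /normq2 /= => /eqP.
rewrite !paddr_eq0 ?addr_ge0 ?sqr_ge0 // !sqrf_eq0.
by move=> /andP[/andP[/andP[/eqP-> /eqP->] /eqP->] /eqP->].
Qed.

Fact mulVq : {in [pred p : quat R | p != 0], left_inverse 1 invq *%R}.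
Proof.
move=> p; rewrite inE -normq2_eq0; case: p => a b c d; rewrite /normq2 /= => h.
by congr Quat; rewrite /= /normq2 /=; field.
Qed.

Fact mulqV : {in [pred p : quat R | p != 0], right_inverse 1 invq *%R}.
Proof.
move=> p; rewrite inE -normq2_eq0; case: p => a b c d; rewrite /normq2 /= => h.
by congr Quat; rewrite /= /normq2 /=; field.
Qed.

Fact unitqP (p q : quat R) :
  q * p = 1 /\ p * q = 1 -> p \in [pred p : quat R | p != 0].
Proof.
by move=> [_ pq1]; rewrite inE; apply: contra_eq_neq pq1 => ->;
   rewrite mul0r eq_sym oner_neq0.
Qed.

Fact invq_out :
  {in [predC [pred p : quat R | p != 0]], invq =1 id}.
Proof.
by move=> p; rewrite !inE negbK => /eqP ->; rewrite /invq /= !mul0r oppr0 !mul0r.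
Qed.

HB.instance Definition _ :=
  GRing.NzRing_hasMulInverse.Build (quat R) mulVq mulqV unitqP invq_out.

End QuatRing.

Section QuatMatrix.
Variable R : realType.
Local Notation H := (quat R).

Definition conjtr m n (A : 'M[H]_(m, n)) : 'M[H]_(n, m) :=
  map_mx (@conjq R) A^T.

Definition frob m n (A : 'M[H]_(m, n)) : R :=
  Num.sqrt (\sum_i \sum_j normq2 (A i j)).

(* Right linear combinations of the columns of A are the products A *m x, whose
   i-th entry is \sum_j A i j * x j. *)
Definition right_colspace m n (A : 'M[H]_(m, n)) : set 'cV[H]_m :=
  range (fun x : 'cV[H]_n => A *m x).

Definition right_free m n (A : 'M[H]_(m, n)) : Prop :=
  forall x : 'cV[H]_n, A *m x = 0 -> x = 0.

(* The right column space of A has dimension r: it has a basis of r vectors,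
   given as the columns of C. (The rank theory of mxalgebra is restricted to
   commutative fields.) *)
Definition has_rank m n (A : 'M[H]_(m, n)) (r : nat) : Prop :=
  exists2 C : 'M[H]_(m, r),
    right_free C & right_colspace C = right_colspace A.

Definition least_squares s m n (A : 'M[H]_(m, n)) (B : 'M[H]_(s, n)) :
    set 'M[H]_(s, m) :=
  [set X | forall Y : 'M[H]_(s, m), frob (X *m A - B) <= frob (Y *m A - B)].

Definition min_norm_least_squares s m n
    (A : 'M[H]_(m, n)) (B : 'M[H]_(s, n)) (X : 'M[H]_(s, m)) : Prop :=
  least_squares A B X /\
  forall Y, least_squares A B Y -> frob X <= frob Y.

Section RowDeterminant.
Variable n : nat.
Implicit Types (M : 'M[H]_n) (alpha : {set 'I_n}) (s : {perm 'I_n}).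

(* The disjoint cycles of a permutation s of alpha, fixed points included, as
   the sequences [:: k; s k; s (s k); ...]: first the cycle opened by i, then
   the others, each opened by its least element, with increasing openers
   ([enum alpha] is increasing). *)
Definition row_cycles alpha (i : 'I_n) s : seq (seq 'I_n) :=
  [seq traject s k #|porbit s k| |
    k <- i :: [seq k <- enum alpha |
                (k \notin porbit s i) && [forall l in porbit s k, (k <= l)%N]]].

(* The i-th row determinant of the principal submatrix of M with rows and
   columns in alpha, for i in alpha, the rows and columns keeping their labels
   from alpha. Permutations of alpha are the permutations of 'I_n that fix every
   point outside alpha. Products are ordered from left to right. *)
Definition rdet_in alpha (i : 'I_n) M : H :=
  \sum_(s : {perm 'I_n} | perm_on alpha s)
    (-1) ^+ (#|alpha| - size (row_cycles alpha i s)) *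
    \prod_(c <- row_cycles alpha i s) \prod_(k <- c) M k (s k).

Definition rdet (i : 'I_n) M : H := rdet_in [set: 'I_n] i M.

(* The determinant of the principal submatrix of a Hermitian M: its row and
   column determinants all coincide, so the row determinant along the least
   element of alpha is taken. *)
Definition hdet_in alpha M : H :=
  if enum alpha is i :: _ then rdet_in alpha i M else 1.

Definition hdet M : H := hdet_in [set: 'I_n] M.

Definition set_row (j : 'I_n) (c : 'rV[H]_n) M : 'M[H]_n :=
  \matrix_(k, l) if k == j then c 0 l else M k l.

End RowDeterminant.
End QuatMatrix.

(* Main.v *)
Require Import Defs.
From mathcomp Require Import classical_sets boolp reals.
From mathcomp Require Import all_boot all_order all_fingroup all_algebra ring lra.

(* Peeling the cycle through j off each permutation gives a recursion: the
   row determinant along j is left linear in row j, with cofactors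
   c^alpha_(l j) that, for l <> j, are minus the row determinants along j of the
   matrix on alpha \ l whose row j is replaced by row l.

   For the Gram matrix G = A A^* one shows, by induction on |alpha|, that the
   cofactor matrix is Hermitian, that G_alpha c^alpha = E(alpha) with E(alpha)
   real, independent of the row j, zero if the rows of A in alpha are dependent
   and positive otherwise.  Reading the recursion from the right expresses
   column j of c^alpha by c^(alpha \ j), so Cramer's rule for alpha follows from
   Cramer's rule for alpha \ j; the sign comes from
   c_j^* G c_j = E(alpha \ j) E(alpha) for the column c_j of c^alpha.

   Summing over |alpha| = k, the matrices C_k of cofactors and the sums D_k of
   principal minors satisfy G C_k = D_k - C_(k+1), the coefficient form of
   (t + G) adj(t + G) = det(t + G).  If A has rank r then D_k = 0 for k > r, which
   forces C_(r+1) A = 0, while D_r > 0.  The minimum norm least squares solution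
   satisfies X G = B A^* and is orthogonal to every Y with Y A = 0, so
   X C_(r+1) = 0 and X D_r = X G C_r = B A^* C_r, which is the claimed formula. *)

Set Implicit Arguments.
Unset Strict Implicit.
Unset Printing Implicit Defensive.

Import Order.TTheory GRing.Theory Num.Theory.
Local Open Scope ring_scope.

(** * Cycles of permutations *)

Section PermutationCycles.
Variable T : finType.
Implicit Types (s t : {perm T}) (x y : T) (c : seq T).

Definition orbit_cycle s x := traject s x #|porbit s x|.

Lemma head_orbit_cycle s x :
  orbit_cycle s x = x :: behead (orbit_cycle s x).
Proof.
rewrite /orbit_cycle; case: #|_| (card_porbit_neq0 s x) => [|k] //.
Qed.

Lemma fcycle_orbit_cycle s x : fcycle s (orbit_cycle s x).
Proof.
rewrite /orbit_cycle; have := iter_porbit s x.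
case: #|_| (card_porbit_neq0 s x) => [|k] //.
move=> _ sx; rewrite /=; have <- : traject s (s x) k.+1 = rcons (traject s (s x) k) x.
  by rewrite trajectSr -iterSr sx.
exact: fpath_traject.
Qed.

Lemma porbit_fcycle s x c :
  uniq (x :: c) -> fcycle s (x :: c) -> porbit s x =i x :: c.
Proof.
move=> uc /= sc y; apply/idP/idP => [/porbitP[i ->]|].
  elim: i => [|i IH]; first by rewrite expg0 perm1 mem_head.
  rewrite expgSr permM.
  have sc' : fcycle s (x :: c) by [].
  by rewrite (eqP (next_cycle sc' IH)) mem_next.
move: sc; rewrite -[x :: c]/([::] ++ x :: c).
move/(@fpathP _ _ x (rcons c x)) => [k Ek].
have Ec : x :: c = traject s x (size (x :: c)).
  have : x :: rcons c x = traject s x k.+1 by rewrite Ek.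
  rewrite -rcons_cons => /(congr1 (take (size c).+1)).
  have Ek' : k = (size c).+1 by rewrite -(size_traject s (s x) k) -Ek size_rcons.
  by rewrite -cats1 take_size_cat // trajectSr Ek' -cats1 take_size_cat ?size_traject.
rewrite Ec => /trajectP[i _ ->]; apply/porbitP; exists i.
by rewrite permX.
Qed.

(** Closing up under [s] without repetition determines the list, so an orbit cycle can be computed
    by exhibiting it. *)
Lemma orbit_cycle_eq s x c :
  uniq (x :: c) -> fcycle s (x :: c) -> orbit_cycle s x = x :: c.
Proof.
move=> uc sc; have Eo := porbit_fcycle uc sc.
have Ec : #|porbit s x| = (size c).+1 by rewrite (eq_card Eo) (card_uniqP uc).
move/(@fpathP _ _ x (rcons c x)): (sc) => [k Ek].
have Ek' : k = (size c).+1 by rewrite -(size_traject s (s x) k) -Ek size_rcons.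
have : x :: rcons c x = traject s x k.+1 by rewrite Ek.
rewrite -rcons_cons => /(congr1 (take (size c).+1)).
rewrite -cats1 take_size_cat // trajectSr Ek' -cats1 take_size_cat ?size_traject //.
by rewrite /orbit_cycle Ec.
Qed.

Lemma uniq_orbit_cycle s x : uniq (orbit_cycle s x).
Proof. exact: uniq_traject_porbit. Qed.

Lemma mem_orbit_cycle s x : orbit_cycle s x =i porbit s x.
Proof. by move=> y; rewrite porbit_traject. Qed.

Lemma eq_orbit_cycle s t x :
  {in porbit s x, s =1 t} -> orbit_cycle t x = orbit_cycle s x.
Proof.
move=> st; rewrite head_orbit_cycle [RHS]head_orbit_cycle -head_orbit_cycle.
apply: orbit_cycle_eq; rewrite -head_orbit_cycle ?uniq_orbit_cycle //.
have : {in orbit_cycle s x &, frel s =2 frel t}.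
  by move=> y z; rewrite mem_orbit_cycle => /st /= -> .
by move/eq_in_cycle <-; rewrite ?fcycle_orbit_cycle //; apply/allP.
Qed.

(** * Inserting a fixed point into a cycle *)

Section Contraction.
Variables (j l : T) (s' : {perm T}).
Hypotheses (jl : j != l) (s'l : s' l = l).
(** Permutations compose from left to right, so [s] sends [j] to [l] and [l] to [s' j]: the fixed
    point [l] of [s'] is inserted right after [j]. *)
Let s := (tperm j l * s')%g.

Lemma insert_permE x : s x = if x == j then l else if x == l then s' j else s' x.
Proof.
rewrite permM; case: tpermP => [->|->|/eqP/negPf-> /eqP/negPf->] //.
  by rewrite eqxx.
by rewrite eq_sym (negPf jl) eqxx.
Qed.

Lemma fixed_notin_porbit x : x != l -> l \notin porbit s' x.
Proof.
rewrite porbit_sym => xl; apply: contra_neqN xl => /porbitP[i ->].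
by elim: i => [|i IH]; rewrite ?expg0 ?perm1 // expgSr permM IH.
Qed.

Lemma orbit_cycle_insert :
  orbit_cycle s j = j :: l :: behead (orbit_cycle s' j).
Proof.
have := fcycle_orbit_cycle s' j; have := uniq_orbit_cycle s' j.
have lN : l \notin orbit_cycle s' j by rewrite mem_orbit_cycle fixed_notin_porbit.
move: lN; rewrite head_orbit_cycle; set c := behead _.
move=> lN uc sc; apply: orbit_cycle_eq.
  move: uc lN; rewrite /= !inE !negb_or jl /= => /andP[-> ->].
  by case/andP=> _ ->.
rewrite /= insert_permE !eqxx /=.
have lc : l \notin c by apply: contra lN; rewrite inE orbC => ->.
have jc : j \notin c by case/andP: uc.
have sl : s l = s' j by rewrite insert_permE eqxx eq_sym (negPf jl).
case: c lc jc sc {lN uc} => [|d c] /= lc jc.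
  by rewrite sl.
rewrite sl => /andP[-> ].
(* After [l] the path meets neither [j] nor [l] until it closes, so there it is a path of [s']. *)
have : {in predC (pred2 j l), s =1 s'}.
  by move=> x; rewrite !inE insert_permE negb_or => /andP[/negPf-> /negPf->].
elim: c d lc jc => [|e c IH] d /=; rewrite !inE ![_ == d]eq_sym.
  move=> dl dj ss'; rewrite ss' ?inE ?negb_or ?dl ?dj //.
move=> /norP[dl lc] /norP[dj jc] ss' /andP[sde sc].
rewrite ss' ?inE ?negb_or ?dl ?dj // sde /=.
by have := IH e; rewrite !inE; apply.
Qed.

Lemma porbit_insert : porbit s j = l |: porbit s' j.
Proof.
apply/setP => x; rewrite !inE -!mem_orbit_cycle orbit_cycle_insert.
by rewrite [orbit_cycle s' j]head_orbit_cycle !inE orbCA.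
Qed.

Lemma orbit_cycle_insert_out x :
  x \notin porbit s j -> orbit_cycle s x = orbit_cycle s' x.
Proof.
rewrite porbit_insert !inE negb_or => /andP[xl xj]; apply: eq_orbit_cycle => y.
rewrite insert_permE => yx; have /negPf-> : y != j.
  by apply: contraNneq xj => <-; rewrite porbit_sym.
suff /negPf-> : y != l by [].
by apply: contraTneq yx => ->; exact: fixed_notin_porbit.
Qed.

End Contraction.
End PermutationCycles.

(** * Least elements of cycles *)

Section Openers.
Variable n : nat.
Implicit Types (s : {perm 'I_n}) (al : {set 'I_n}).

Definition openers al s : seq 'I_n :=
  [seq k <- enum al | [forall l in porbit s k, (k <= l)%N]].

Definition openers_off al s j := [seq k <- openers al s | k \notin porbit s j].

Lemma row_cyclesE al j s :
  row_cycles al j s = map (orbit_cycle s) (j :: openers_off al s j).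
Proof. by rewrite /row_cycles /openers_off /openers filter_predI. Qed.

Lemma perm_on_porbit al s x y :
  perm_on al s -> x \in al -> y \in porbit s x -> y \in al.
Proof.
move=> sal xal /porbitP[i ->]; elim: i => [|i IH]; first by rewrite expg0 perm1.
by rewrite expgSr permM perm_closed.
Qed.

(** The openers are distinct points of [al]. The bound keeps the truncated subtraction in the sign
    exponent exact. *)
Lemma size_row_cycles al j s :
  j \in al -> (size (row_cycles al j s) <= #|al|)%N.
Proof.
move=> jal; rewrite row_cyclesE size_map cardE uniq_leq_size //.
  rewrite /= mem_filter porbit_id /=.
  by do 2 apply: filter_uniq; exact: enum_uniq.
move=> k; rewrite inE => /predU1P[->|]; first by rewrite mem_enum.
by rewrite !mem_filter => /and3P[].
Qed.


End Openers.

(** * Expansion of row determinants along a row *)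

Section Expansion.
Variables (R : realType) (n : nat).
Local Notation H := (quat R).
Implicit Types (M : 'M[H]_n) (al : {set 'I_n}) (s : {perm 'I_n}).

Definition cycle_prod M s k : H := \prod_(x <- orbit_cycle s k) M x (s x).

Lemma enum_ord_head_lt al (i : 'I_n) e :
  enum al = i :: e -> {in e, forall k : 'I_n, (i < k)%N}.
Proof.
move=> E k ke.
have : sorted ltn (map val (enum al)).
  rewrite -[enum _](eq_filter (mem_enum _)).
  rewrite -(eq_filter (mem_map val_inj _)) -filter_map.
  by rewrite (sorted_filter ltn_trans) // unlock val_ord_enum iota_ltn_sorted.
rewrite E /= => /(order_path_min ltn_trans)/allP; apply.
by apply/mapP; exists k.
Qed.

Lemma openers_head al i e s :
  enum al = i :: e -> perm_on al s -> openers al s = i :: openers_off al s i.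
Proof.
move=> E sal.
have ial : i \in al by rewrite -mem_enum E mem_head.
have le_i k : k \in al -> (i <= k)%N.
  rewrite -mem_enum E inE => /predU1P[->//|/(enum_ord_head_lt E)]; exact: ltnW.
have imin : [forall l in porbit s i, (i <= l)%N].
  by apply/forall_inP => l /(perm_on_porbit sal ial)/le_i.
rewrite /openers_off /openers -filter_predI E /= imin /= porbit_id /=.
congr cons; apply: eq_in_filter => k /= ke.
case: (boolP (k \in porbit s i)) => //= ki.
apply/negbTE/negP => /forall_inP/(_ i); rewrite porbit_sym => /(_ ki).
by rewrite leqNgt (enum_ord_head_lt E).
Qed.

(** The least element of [al] opens its own cycle anyway, so along that row the first cycle follows
    the same rule as the others and no row is distinguished. *)
Lemma hdet_inE al M :
  hdet_in al M = \sum_(s : {perm 'I_n} | perm_on al s)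
    (-1) ^+ (#|al| - size (openers al s)) *
      \prod_(k <- openers al s) cycle_prod M s k.
Proof.
rewrite /hdet_in; case E : (enum al) => [|i e].
  (* On the empty set only the identity remains, with an empty product, in agreement with the
     default value 1. *)
  have al0 : al = finset.set0 by apply/setP => x; rewrite -mem_enum E !inE.
  rewrite (big_pred1 1%g) => [|s].
    by rewrite /openers E big_nil cardE E expr0 mulr1.
  rewrite al0 /=; apply/idP/eqP => [s0|->]; last exact: perm_on1.
  by apply: (perm_on_id s0); rewrite cards0.
rewrite /rdet_in; apply: eq_bigr => s sal.
by rewrite row_cyclesE size_map big_map -(openers_head E sal).
Qed.

(** Entry [(l, j)] of a noncommutative adjugate on [al]. Off the diagonal, row [l] replaces row [j]:
    once [l] is deleted from the cycle, [j] inherits the image of [l]. *)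
Definition row_cofactor M al (l j : 'I_n) : H :=
  if l == j then hdet_in (al :\ j) M
  else - rdet_in (al :\ l) j (set_row j (row l M) M).

Lemma cycle_prod_set_row M (v : 'rV[H]_n) s j k :
  k \notin porbit s j -> cycle_prod (set_row j v M) s k = cycle_prod M s k.
Proof.
move=> kj; rewrite /cycle_prod !big_seq; apply: eq_bigr => x.
rewrite mem_orbit_cycle mxE => xk; case: eqP xk kj => // ->.
by rewrite porbit_sym => ->.
Qed.

Lemma rdet_in_set_rowE M (v : 'rV[H]_n) al j :
  rdet_in al j (set_row j v M) =
  \sum_(s : {perm 'I_n} | perm_on al s)
    (-1) ^+ (#|al| - (size (openers_off al s j)).+1) *
    (cycle_prod (set_row j v M) s j *
     \prod_(k <- openers_off al s j) cycle_prod M s k).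
Proof.
rewrite /rdet_in; apply: eq_bigr => s _.
rewrite row_cyclesE size_map big_map big_cons; congr (_ * (_ * _)).
rewrite !big_seq; apply: eq_bigr => k; rewrite mem_filter => /andP[kj _].
exact: cycle_prod_set_row.
Qed.

Lemma perm_on_setD1 al s j : perm_on (al :\ j) s = perm_on al s && (s j == j).
Proof.
apply/idP/andP => [sal|[sal /eqP sj]].
  split; last by rewrite (out_perm sal) // !inE eqxx.
  exact: fintype.subset_trans sal (subD1set _ _).
apply/fintype.subsetP => x xs; rewrite !inE (fintype.subsetP sal x xs) andbT.
by apply: contraNneq xs => ->; rewrite sj.
Qed.

Lemma rdet_in_fixed M (v : 'rV[H]_n) al j : j \in al ->
  \sum_(s : {perm 'I_n} | perm_on al s && (s j == j))
    (-1) ^+ (#|al| - (size (openers_off al s j)).+1) *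
    (cycle_prod (set_row j v M) s j *
     \prod_(k <- openers_off al s j) cycle_prod M s k) =
  v 0 j * hdet_in (al :\ j) M.
Proof.
move=> jal; rewrite hdet_inE big_distrr /=.
apply: eq_big => [s|s /andP[sal /eqP sj]]; first by rewrite perm_on_setD1.
have oc : orbit_cycle s j = [:: j].
  by apply: orbit_cycle_eq => //=; rewrite sj eqxx.
have po : porbit s j =i [:: j] by move=> x; rewrite -mem_orbit_cycle oc.
have Eoff : openers_off al s j = openers (al :\ j) s.
  rewrite /openers_off /openers /enum_mem -!filter_predI; apply: eq_filter => k /=.
  by rewrite !inE po inE; do !case: (_ == _); do !case: (_ \in _); rewrite ?andbF.
rewrite Eoff.
(* Points and cycles both drop by one, so the sign is kept. *)
rewrite (cardsD1 j al) jal add1n subSS.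
rewrite {1}/cycle_prod oc big_seq1 mxE eqxx sj.
by rewrite [RHS]mulrA (commr_sign (v 0 j)) -mulrA.
Qed.

(* The involution s |-> tperm j l * s deletes l = s j from the cycle of j. *)
Lemma rdet_in_moved M (v : 'rV[H]_n) al j l : j \in al -> l \in al -> l != j ->
  \sum_(s : {perm 'I_n} | perm_on al s && (s j == l))
    (-1) ^+ (#|al| - (size (openers_off al s j)).+1) *
    (cycle_prod (set_row j v M) s j *
     \prod_(k <- openers_off al s j) cycle_prod M s k) =
  - (v 0 l * rdet_in (al :\ l) j (set_row j (row l M) M)).
Proof.
move=> jal lal lj; have jl : j != l by rewrite eq_sym.
have jal' : j \in al :\ l by rewrite !inE jl.
rewrite rdet_in_set_rowE big_distrr /= -sumrN.
have tK : involutive (fun s => tperm j l * s)%g by move=> s; rewrite mulgA tperm2 mul1g.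
rewrite (reindex_inj (inv_inj tK)) /=.
apply: eq_big => [s|s].
  rewrite perm_on_setD1 permM tpermL.
  case: (boolP (s l == l)) => _; rewrite ?andbF // !andbT.
  have tal : perm_on al (tperm j l).
    by apply: (fintype.subset_trans (tperm_on _ _));
       apply/fintype.subsetP => x; rewrite !inE => /orP[]/eqP->.
  apply/idP/idP => sal; last exact: perm_onM.
  by rewrite -[s]tK; apply: perm_onM.
rewrite permM tpermL => /andP[sal /eqP sl].
have Eoff : openers_off al (tperm j l * s)%g j = openers_off (al :\ l) s j.
  rewrite /openers_off /openers /enum_mem -!filter_predI; apply: eq_filter => k /=.
  rewrite porbit_insert // !inE negb_or.
  case: (boolP (k == l)) => [/eqP ->|kl] /=; first by rewrite !andbF.
  case: (boolP (k \in porbit s j)) => //= kj.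
  congr (_ && _); apply: eq_forallb => x.
  by rewrite -!mem_orbit_cycle orbit_cycle_insert_out // porbit_insert // !inE negb_or kl.
have := size_row_cycles s jal'; rewrite row_cyclesE size_map /=.
rewrite Eoff (cardsD1 l al) lal add1n => /= szle.
(* One point is lost but no cycle, hence the factor -1. *)
rewrite subSn // exprS !mulNr mul1r; congr (- _).
rewrite [RHS]mulrA (commr_sign (v 0 l)) -[RHS]mulrA; congr (_ * _).
rewrite [in RHS]mulrA; congr (_ * _).
  (* In the first cycle the factor at [j] is [v 0 l]; the next one is read in row [l] of [M], which
     is row [j] after the contraction. *)
  rewrite /cycle_prod orbit_cycle_insert // [orbit_cycle s j]head_orbit_cycle !big_cons.
  rewrite !mxE !eqxx /= (negPf lj) !insert_permE // !eqxx (negPf lj).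
  congr (_ * (_ * _)).
  have : uniq (orbit_cycle s j) by exact: uniq_orbit_cycle.
  have : l \notin orbit_cycle s j by rewrite mem_orbit_cycle fixed_notin_porbit.
  rewrite head_orbit_cycle inE negb_or /= => /andP[_ lc] /andP[jc _].
  rewrite !big_seq; apply: eq_bigr => x xc; rewrite !mxE insert_permE //.
  by rewrite !(negPf (memPn jc x xc)) (negPf (memPn lc x xc)).
rewrite !big_seq; apply: eq_bigr => k; rewrite mem_filter => /andP[kj].
rewrite mem_filter mem_enum => /andP[_]; rewrite !inE => /andP[kl kal].
rewrite /cycle_prod orbit_cycle_insert_out ?porbit_insert // ?inE ?negb_or ?kl //.
rewrite !big_seq; apply: eq_bigr => x; rewrite mem_orbit_cycle => xk.
rewrite insert_permE //.
have /negPf-> : x != j by apply: contraNneq kj => <-; rewrite porbit_sym.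
suff /negPf-> : x != l by [].
by apply: contraTneq xk => ->; exact: fixed_notin_porbit.
Qed.

(** The permutations are sorted by the image [l] of [j]. The entry of row [j] is the leftmost factor
    of each product, so the cofactors stand on the right. *)
Lemma rdet_in_expand M (v : 'rV[H]_n) al j : j \in al ->
  rdet_in al j (set_row j v M) = \sum_(l in al) v 0 l * row_cofactor M al l j.
Proof.
move=> jal; rewrite rdet_in_set_rowE.
rewrite (partition_big (fun s : {perm 'I_n} => s j) (mem al)) /=; last first.
  by move=> s sal; rewrite perm_closed.
apply: eq_bigr => l lal; rewrite /row_cofactor; case: eqVneq => [->|lj].
  exact: rdet_in_fixed.
by rewrite rdet_in_moved // mulrN.
Qed.

End Expansion.

(** * Principal minors of Gram matrices *)

Section QuaternionConjugation.
Variable R : realType.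
Local Notation H := (quat R).
Implicit Types p q : H.

Lemma conjqD p q : conjq (p + q) = conjq p + conjq q.
Proof. by case: p q => [a b c d] [a' b' c' d']; congr Quat => /=; rewrite opprD. Qed.

Lemma conjqM p q : conjq (p * q) = conjq q * conjq p.
Proof. by case: p q => [a b c d] [a' b' c' d']; congr Quat => /=; ring. Qed.

Lemma conjqK : involutive (@conjq R).
Proof. by case=> a b c d; rewrite /conjq /= !opprK. Qed.

Lemma conjq0 : conjq 0 = 0 :> H.
Proof. by congr Quat; rewrite oppr0. Qed.

Lemma conjqN p : conjq (- p) = - conjq p.
Proof. by []. Qed.

Lemma conjq1 : conjq 1 = 1 :> H.
Proof. by congr Quat; rewrite oppr0. Qed.

Lemma conjq_sum I (r : seq I) (P : pred I) (F : I -> H) :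
  conjq (\sum_(i <- r | P i) F i) = \sum_(i <- r | P i) conjq (F i).
Proof. exact: (big_morph _ conjqD conjq0). Qed.

Lemma qr_sum I (r : seq I) (P : pred I) (F : I -> H) :
  qr (\sum_(i <- r | P i) F i) = \sum_(i <- r | P i) qr (F i).
Proof. by apply: (big_morph (@qr R)). Qed.

Lemma conjq_realP q : conjq q = q -> q = Quat (qr q) 0 0 0.
Proof.
by case: q => a b c d [? ? ?]; congr Quat; lra.
Qed.

(** Self-conjugate quaternions are real. This substitutes for commutativity once the minors are
    known to be real. *)
Lemma conjq_central q p : conjq q = q -> q * p = p * q.
Proof.
by move/conjq_realP ->; case: p => a b c d; congr Quat => /=; ring.
Qed.

Lemma qr_conjMl p : qr (conjq p * p) = normq2 p.
Proof. by case: p => a b c d; rewrite /normq2 /=; ring. Qed.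

Lemma qr_conjMr p : qr (p * conjq p) = normq2 p.
Proof. by case: p => a b c d; rewrite /normq2 /=; ring. Qed.

Lemma normq2_ge0 p : 0 <= normq2 p.
Proof. by rewrite /normq2 !addr_ge0 ?sqr_ge0. Qed.

Lemma unitq q : (q \is a GRing.unit) = (q != 0).
Proof. by []. Qed.

Lemma mulq_eq0 p q : (p * q == 0) = (p == 0) || (q == 0).
Proof.
apply/eqP/orP => [pq0|[]/eqP->]; rewrite ?mul0r ?mulr0 //.
have [_|p0] := eqVneq p 0; [by left|right].
by rewrite -[q](mulKr (x := p)) ?unitq // pq0 mulr0.
Qed.

End QuaternionConjugation.

Section ConjugateTranspose.
Variable R : realType.
Local Notation H := (quat R).

Lemma conjtrE m n (A : 'M[H]_(m, n)) i j : conjtr A i j = conjq (A j i).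
Proof. by rewrite !mxE. Qed.

Lemma conjtrK m n (A : 'M[H]_(m, n)) : conjtr (conjtr A) = A.
Proof. by apply/matrixP => i j; rewrite !conjtrE conjqK. Qed.

Lemma conjtrM m n p (A : 'M[H]_(m, n)) (B : 'M[H]_(n, p)) :
  conjtr (A *m B) = conjtr B *m conjtr A.
Proof.
apply/matrixP => i j; rewrite conjtrE !mxE conjq_sum; apply: eq_bigr => k _.
by rewrite conjqM !conjtrE.
Qed.

Lemma conjtr0 m n : conjtr (0 : 'M[H]_(m, n)) = 0.
Proof. by apply/matrixP => i j; rewrite !mxE conjq0. Qed.

(** The diagonal entries are the sums of squared moduli of the columns of [Z]. *)
Lemma conjtr_mulmx_eq0 m n (Z : 'M[H]_(m, n)) : conjtr Z *m Z = 0 -> Z = 0.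
Proof.
move=> Z0; apply/matrixP => i j; rewrite mxE; apply/eqP; rewrite -normq2_eq0.
have /(congr1 (@qr R)) : (conjtr Z *m Z) j j = 0 by rewrite Z0 mxE.
rewrite mxE qr_sum => /eqP; rewrite psumr_eq0 => [/allP/(_ i)|k _].
  by rewrite mem_index_enum conjtrE qr_conjMl => /(_ isT).
by rewrite conjtrE qr_conjMl normq2_ge0.
Qed.

End ConjugateTranspose.

(** * Recursion for the cofactors *)

Section CofactorRecursion.
Variables (R : realType) (n : nat).
Local Notation H := (quat R).
Implicit Types (M : 'M[H]_n) (al : {set 'I_n}).

Lemma row_cofactor_diag M al j : row_cofactor M al j j = hdet_in (al :\ j) M.
Proof. by rewrite /row_cofactor eqxx. Qed.

Lemma row_cofactor_rec M al l j : j \in al -> l != j ->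
  row_cofactor M al l j =
  - \sum_(k in al :\ l) M l k * row_cofactor M (al :\ l) k j.
Proof.
move=> jal lj; rewrite {1}/row_cofactor (negPf lj) rdet_in_expand; last first.
  by rewrite !inE eq_sym lj.
by congr (- _); apply: eq_bigr => k _; rewrite mxE.
Qed.

Lemma rdet_in_cofactor M al j : j \in al ->
  rdet_in al j M = \sum_(l in al) M j l * row_cofactor M al l j.
Proof.
move=> jal; have {1}-> : M = set_row j (row j M) M.
  by apply/matrixP => k l; rewrite !mxE; case: eqP => // ->.
by rewrite rdet_in_expand //; apply: eq_bigr => l _; rewrite mxE.
Qed.

Lemma hdet_in_rdet M al : al != finset.set0 ->
  exists2 j, j \in al & hdet_in al M = rdet_in al j M.
Proof.
rewrite /hdet_in; case E : (enum al) => [|i e]; last first.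
  by exists i; rewrite // -mem_enum E mem_head.
by case/set0Pn => x; rewrite -mem_enum E.
Qed.

Lemma hdet_in0 M : hdet_in finset.set0 M = 1.
Proof. by rewrite /hdet_in enum_set0. Qed.

End CofactorRecursion.

(** * Hermitian symmetry, Cramer's rule and sign of the minors of [A A^*] *)

Section GramMinors.
Variables (R : realType) (m n : nat).
Local Notation H := (quat R).
Variable A : 'M[H]_(m, n).
Let G := A *m conjtr A.
Implicit Types (al be : {set 'I_m}).

(** Conjugating [A^* x = 0] gives [x^* A = 0], a left linear relation between the rows of [A]
    indexed by [al]. *)
Definition dependent_rows al := exists x : 'cV[H]_m,
  [/\ x != 0, forall i, i \notin al -> x i 0 = 0 & conjtr A *m x = 0].

(** The properties are bundled so that a single induction on [#|al|] proves them together. *)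
Record gram_minor al : Prop := GramMinor {
  gram_herm : {in al &, forall l j,
    conjq (row_cofactor G al l j) = row_cofactor G al j l};
  gram_cramer : {in al &, forall p j,
    \sum_(l in al) G p l * row_cofactor G al l j =
    if p == j then hdet_in al G else 0};
  gram_real : conjq (hdet_in al G) = hdet_in al G;
  gram_rdet : {in al, forall j, rdet_in al j G = hdet_in al G};
  gram_dependent : dependent_rows al -> hdet_in al G = 0;
  gram_independent : ~ dependent_rows al -> 0 < qr (hdet_in al G) }.

Lemma gram_conj i j : conjq (G i j) = G j i.
Proof. by rewrite -conjtrE conjtrM conjtrK. Qed.

Lemma dependent_rowsS al be : al \subset be ->
  dependent_rows al -> dependent_rows be.
Proof.
move=> /fintype.subsetP sab [x [x0 xal Kx]]; exists x; split=> // i ibe.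
by apply: xal; apply: contra ibe; apply: sab.
Qed.

Lemma gram_mul_eq0 p (Y : 'M[H]_(m, p)) : G *m Y = 0 -> conjtr A *m Y = 0.
Proof.
move=> GY; apply: conjtr_mulmx_eq0.
by rewrite conjtrM conjtrK -mulmxA (mulmxA A) GY mulmx0.
Qed.

Lemma not_dependent_rows0 : ~ dependent_rows finset.set0.
Proof.
move=> [x [/eqP x0 x_ _]]; apply: x0; apply/colP => i.
by rewrite x_ ?inE // mxE.
Qed.

Section Step.
Variable al : {set 'I_m}.
Hypothesis IH : forall be, (#|be| < #|al|)%N -> gram_minor be.
Local Notation cof := (row_cofactor G).

Let IH1 j : j \in al -> gram_minor (al :\ j).
Proof. by move=> jal; apply: IH; rewrite [X in (_ < X)%N](cardsD1 j) jal. Qed.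

Let IH2 j l : j \in al -> gram_minor (al :\ j :\ l).
Proof.
move=> jal; apply: IH; apply: leq_ltn_trans (subset_leq_card (subD1set _ _)) _.
by rewrite [X in (_ < X)%N](cardsD1 j) jal.
Qed.

Lemma setD1C j l : al :\ j :\ l = al :\ l :\ j.
Proof. by apply/setP => x; rewrite !inE andbCA. Qed.

(** Expanding twice turns both sides into the same double sum of [G j k' * c k' k * G k l], where
    [c] is the cofactor on [al] without [l] and [j]. *)
Lemma step_herm :
  {in al &, forall l j, conjq (cof al l j) = cof al j l}.
Proof.
move=> l j lal jal; have [->|lj] := eqVneq l j.
  by rewrite row_cofactor_diag (gram_real (IH1 jal)).
have jl : j != l by rewrite eq_sym.
have ljal : l \in al :\ j by rewrite !inE lj.
have jlal : j \in al :\ l by rewrite !inE jl.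
rewrite (row_cofactor_rec _ jal lj) (row_cofactor_rec _ lal jl) conjqN.
congr (- _); rewrite conjq_sum.
(* The terms split off carry diagonal cofactors; both are the minor of [al] without [l] and [j],
   which is real and hence central. *)
rewrite (big_setD1 j jlal) [RHS](big_setD1 l ljal) /=.
rewrite conjqM gram_conj !row_cofactor_diag (gram_real (IH2 _ lal)).
rewrite (conjq_central _ (gram_real (IH2 _ lal))) (setD1C j l); congr (_ + _).
set ga := al :\ l :\ j; have gaE : ga = al :\ j :\ l by rewrite setD1C.
transitivity (\sum_(k in ga) \sum_(k' in ga) - (G j k' * cof ga k' k * G k l)).
  apply: eq_bigr => k kga; have /[!inE]/and3P[kj kl kal] := kga.
  have klal : k \in al :\ l by rewrite !inE kl.
  rewrite conjqM gram_conj (gram_herm (IH1 lal)) //.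
  by rewrite row_cofactor_rec // 1?eq_sym // mulNr big_distrl /= -sumrN.
rewrite exchange_big /=; apply: eq_bigr => k kga.
have /[!inE]/and3P[kj kl kal] := kga.
have kjal : k \in al :\ j by rewrite !inE kj.
rewrite -(gram_herm (IH1 jal)) // row_cofactor_rec // 1?eq_sym //.
rewrite conjqN mulrN conjq_sum big_distrr /= -gaE -sumrN.
apply: eq_bigr => k' k'ga; congr (- _).
by rewrite conjqM gram_conj (gram_herm (IH2 _ lal)) // mulrA.
Qed.

(** The conjugate of [row_cofactor_rec]: the index removed is now [j], so column [j] on [al] reduces
    to cofactors on [al :\ j]. *)
Lemma step_right l j : l \in al -> j \in al -> l != j ->
  cof al l j = - \sum_(k in al :\ j) cof (al :\ j) l k * G k j.
Proof.
move=> lal jal lj; rewrite -step_herm // row_cofactor_rec // 1?eq_sym //.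
rewrite conjqN conjq_sum; congr (- _); apply: eq_bigr => k kal.
by rewrite conjqM gram_conj (gram_herm (IH1 jal)) // !inE lj.
Qed.

Lemma step_cramer : {in al &, forall p j,
  \sum_(l in al) G p l * cof al l j = if p == j then rdet_in al j G else 0}.
Proof.
move=> p j pal jal; case: eqVneq => [->|pj]; first by rewrite rdet_in_cofactor.
have pb : p \in al :\ j by rewrite !inE pj.
rewrite (big_setD1 j jal) /= row_cofactor_diag.
transitivity (G p j * hdet_in (al :\ j) G -
  \sum_(k in al :\ j) (\sum_(l in al :\ j) G p l * cof (al :\ j) l k) * G k j).
  congr (_ + _); under [in RHS]eq_bigr do rewrite big_distrl /=.
  rewrite exchange_big -sumrN; apply: eq_bigr => l /[!inE]/andP[lj lal].
  rewrite step_right // mulrN big_distrr /=; congr (- _).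
  by apply: eq_bigr => k _; rewrite mulrA.
(* Cramer's rule on [al :\ j] leaves only [k = p]; the real minor moves past [G p j] and the two
   terms cancel. *)
rewrite (big_setD1 p pb) /= (gram_cramer (IH1 jal)) // eqxx.
rewrite (conjq_central _ (gram_real (IH1 jal))) big1 ?addr0 ?subrr // => k.
rewrite inE => /andP[]; rewrite inE => kp kb.
by rewrite (gram_cramer (IH1 jal)) // eq_sym (negPf kp) mul0r.
Qed.

(** Expanding in row [j] and then with [step_right] gives a double sum of [G j k * c k l * G l j],
    which conjugation merely transposes. *)
Lemma step_real j : j \in al -> conjq (rdet_in al j G) = rdet_in al j G.
Proof.
move=> jal; rewrite rdet_in_cofactor // conjq_sum.
have E k : k \in al -> k != j -> G j k * cof al k j =
    \sum_(l in al :\ j) - (G j k * cof (al :\ j) k l * G l j).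
  move=> kal kj; rewrite step_right // mulrN big_distrr -sumrN /=.
  by apply: eq_bigr => l _; rewrite mulrA.
rewrite (big_setD1 j jal) [RHS](big_setD1 j jal) /=.
rewrite conjqM gram_conj row_cofactor_diag (gram_real (IH1 jal)).
rewrite (conjq_central _ (gram_real (IH1 jal))); congr (_ + _).
transitivity (\sum_(k in al :\ j) \sum_(l in al :\ j)
                - (G j l * cof (al :\ j) l k * G k j)).
  apply: eq_bigr => k kb; have /[!inE]/andP[kj kal] := kb.
  rewrite E // conjq_sum; apply: eq_bigr => l lb.
  by rewrite conjqN !conjqM !gram_conj (gram_herm (IH1 jal)) // mulrA.
rewrite exchange_big /=; apply: eq_bigr => k /[!inE]/andP[kj kal].
by rewrite E.
Qed.

Lemma step_cramer_left : {in al &, forall p j,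
  \sum_(l in al) cof al p l * G l j = if p == j then rdet_in al j G else 0}.
Proof.
move=> p j pal jal; transitivity (conjq (\sum_(l in al) G j l * cof al l p)).
  rewrite conjq_sum; apply: eq_bigr => l lal.
  by rewrite conjqM gram_conj step_herm.
rewrite step_cramer // eq_sym; case: eqP => [->|_]; last exact: conjq0.
exact: step_real.
Qed.

Definition cofactor_col j : 'cV[H]_m := \col_l (if l \in al then cof al l j else 0).

Lemma gram_cofactor_col j p :
  (G *m cofactor_col j) p 0 = \sum_(l in al) G p l * cof al l j.
Proof.
rewrite mxE [RHS]big_mkcond; apply: eq_bigr => l _.
by rewrite [cofactor_col _ _ _]mxE; case: ifP => _; rewrite ?mulr0.
Qed.

(** The left side is [c^* G c] for the cofactor column [c]. As [c] vanishes off [al], Cramer's rule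
    leaves the single term at [j]. Being a squared length, it controls the sign of the minor. *)
Lemma step_schur j : j \in al ->
  (conjtr (conjtr A *m cofactor_col j) *m (conjtr A *m cofactor_col j)) 0 0 =
  hdet_in (al :\ j) G * rdet_in al j G.
Proof.
move=> jal; rewrite conjtrM conjtrK -mulmxA (mulmxA A) -/G mxE (bigD1 j) //=.
rewrite gram_cofactor_col step_cramer // eqxx conjtrE mxE jal row_cofactor_diag.
rewrite (gram_real (IH1 jal)) big1 ?addr0 // => k kj.
rewrite conjtrE [X in conjq X]mxE; case: ifP => kal; last by rewrite conjq0 mul0r.
by rewrite gram_cofactor_col step_cramer // (negPf kj) mulr0.
Qed.

Lemma step_dependent j : j \in al -> dependent_rows al -> rdet_in al j G = 0.
Proof.
(* If the minor on [al :\ j] is zero, [step_schur] gives [A^* c = 0], so entry [j] of [G c], the row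
   determinant, vanishes. *)
move=> jal dal; have [E0|E0] := eqVneq (hdet_in (al :\ j) G) 0.
  have /conjtr_mulmx_eq0 K0 : conjtr (conjtr A *m cofactor_col j) *m
      (conjtr A *m cofactor_col j) = 0.
    by apply/matrixP => i i'; rewrite !ord1 step_schur // E0 mul0r mxE.
  have := gram_cofactor_col j j; rewrite step_cramer // eqxx => <-.
  by rewrite /G -mulmxA K0 mulmx0 mxE.
(* Otherwise the rows in [al :\ j] are independent, so the relation [x] has [x j 0 != 0], and the
   left Cramer rule applied to [G x = 0] kills the determinant. *)
have [x [x0 xal Kx]] := dal.
have xj : x j 0 != 0.
  apply: contraNneq E0 => xj; apply/eqP/(gram_dependent (IH1 jal)).
  exists x; split=> // i; rewrite !inE negb_and negbK => /orP[/eqP-> //|].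
  exact: xal.
have Gx l : \sum_(k in al) G l k * x k 0 = 0.
  transitivity ((G *m x) l 0); last by rewrite /G -mulmxA Kx mulmx0 mxE.
  rewrite mxE [LHS]big_mkcond; apply: eq_bigr => k _.
  by case: ifPn => // /xal ->; rewrite mulr0.
have : \sum_(k in al) (\sum_(l in al) cof al j l * G l k) * x k 0 = 0.
  under eq_bigr do rewrite big_distrl /=.
  rewrite exchange_big big1 // => l _.
  by under eq_bigr do rewrite -mulrA; rewrite -big_distrr /= Gx mulr0.
rewrite (big_setD1 j jal) /= step_cramer_left // eqxx big1 ?addr0 => [/eqP|k].
  by rewrite mulq_eq0 (negPf xj) orbF => /eqP.
rewrite !inE => /andP[kj kal].
by rewrite step_cramer_left // eq_sym (negPf kj) mul0r.
Qed.

Lemma qr_mul_real p q : conjq p = p -> qr (p * q) = qr p * qr q :> R.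
Proof. by move/conjq_realP ->; rewrite /= !mul0r !subr0. Qed.

(** The squared length in [step_schur] cannot vanish: the cofactor column would be a relation,
    nonzero because its entry [j] is the positive minor on [al :\ j]. *)
Lemma step_independent j : j \in al -> ~ dependent_rows al ->
  0 < qr (rdet_in al j G).
Proof.
move=> jal dal; have sub : al :\ j \subset al by exact: subD1set.
have Epos := gram_independent (IH1 jal) (fun d => dal (dependent_rowsS sub d)).
rewrite -(pmulr_rgt0 _ Epos) -qr_mul_real ?(gram_real (IH1 jal)) // -step_schur //.
rewrite lt0r mxE qr_sum; apply/andP; split; last first.
  by apply: sumr_ge0 => k _; rewrite conjtrE qr_conjMl normq2_ge0.
apply/eqP => S0; apply: dal; exists (cofactor_col j); split.
- apply/eqP => /matrixP/(_ j 0); rewrite !mxE jal row_cofactor_diag => E0.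
  by rewrite E0 ltxx in Epos.
- by move=> i ial; rewrite mxE (negPf ial).
apply/colP => k; rewrite [RHS]mxE; apply/eqP; rewrite -normq2_eq0.
move/eqP: S0; rewrite psumr_eq0 => [/allP/(_ k)|l _].
  by rewrite mem_index_enum conjtrE qr_conjMl => /(_ isT).
by rewrite conjtrE qr_conjMl normq2_ge0.
Qed.

(** Evaluating cofactors times [G] times cofactors at [(j, p)] by the left and by the right Cramer
    rule gives [R_j c = c R_p] with [c = cof al j p]. Since [R_j] is central, a nonzero [c]
    cancels. *)
Lemma step_rdet_eq : {in al &, forall j p, rdet_in al j G = rdet_in al p G}.
Proof.
move=> j p jal pal; have [->//|jp] := eqVneq j p.
have [dal|dal] := pselect (dependent_rows al); first by rewrite !step_dependent.
have RGR : rdet_in al j G * cof al j p = cof al j p * rdet_in al p G.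
  transitivity (\sum_(k in al) (\sum_(l in al) cof al j l * G l k) * cof al k p).
    rewrite (big_setD1 j jal) /= step_cramer_left // eqxx big1 ?addr0 // => k.
    rewrite !inE => /andP[kj kal].
    by rewrite step_cramer_left // eq_sym (negPf kj) mul0r.
  under eq_bigr do rewrite big_distrl /=.
  rewrite exchange_big /=.
  transitivity (\sum_(l in al) cof al j l * (if l == p then rdet_in al p G else 0)).
    apply: eq_bigr => l lal; under eq_bigr do rewrite -mulrA.
    by rewrite -big_distrr /= step_cramer.
  rewrite (big_setD1 p pal) /= eqxx big1 ?addr0 // => l.
  by rewrite !inE => /andP[/negPf-> _]; rewrite mulr0.
have [c0|c0] := eqVneq (cof al j p) 0; last first.
  move: RGR; rewrite (conjq_central _ (step_real jal)).
  by apply: mulrI; rewrite unitq.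
(* If c_(a b) = 0, then column b of the cofactors of al lives on al \ a, where it
   is proportional to column b of the cofactors of al \ a.  Comparing the entries
   in row b gives an identity symmetric in a and b up to the rdet factor. *)
have key a b : a \in al -> b \in al -> a != b -> cof al a b = 0 ->
    hdet_in (al :\ a :\ b) G * rdet_in al b G =
    hdet_in (al :\ a) G * hdet_in (al :\ b) G.
  move=> aal bal ab cab; have ba : b \in al :\ a by rewrite !inE eq_sym ab.
  have Gb q : q \in al -> \sum_(l in al :\ a) G q l * cof al l b =
      if q == b then rdet_in al b G else 0.
    move=> qal; rewrite -step_cramer // (big_setD1 a aal) /= cab mulr0 add0r //.
  transitivity (\sum_(q in al :\ a) cof (al :\ a) b q *
                  (\sum_(l in al :\ a) G q l * cof al l b)).
    rewrite (big_setD1 b ba) /= Gb // eqxx row_cofactor_diag big1 ?addr0 // => q.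
    by rewrite !inE => /and3P[qb qa qal]; rewrite Gb // (negPf qb) mulr0.
  under eq_bigr do rewrite big_distrr /=.
  rewrite exchange_big /=.
  transitivity (\sum_(l in al :\ a)
      (if l == b then hdet_in (al :\ a) G else 0) * cof al l b).
    apply: eq_bigr => l la; under eq_bigr do rewrite mulrA.
    rewrite -big_distrl /=; congr (_ * _).
    transitivity (conjq (\sum_(q in al :\ a) G l q * cof (al :\ a) q b)).
      rewrite conjq_sum; apply: eq_bigr => q qa.
      by rewrite conjqM gram_conj (gram_herm (IH1 aal)).
    rewrite (gram_cramer (IH1 aal)) //; case: eqP => _; last exact: conjq0.
    exact: (gram_real (IH1 aal)).
  rewrite (big_setD1 b ba) /= eqxx row_cofactor_diag big1 ?addr0 // => l.
  by rewrite inE => /andP[]; rewrite inE => /negPf-> _; rewrite mul0r.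
have c0' : cof al p j = 0 by rewrite -step_herm // c0 conjq0.
have sub : al :\ j :\ p \subset al.
  by apply: fintype.subset_trans (subD1set _ _) (subD1set _ _).
(* The minor of [al] without [j] and [p] is positive by independence, hence cancels between the two
   instances of [key]. *)
have Epos := gram_independent (IH2 p jal) (fun d => dal (dependent_rowsS sub d)).
have E0 : hdet_in (al :\ j :\ p) G != 0.
  by apply: contraTneq Epos => ->; rewrite ltxx.
apply: (mulrI (x := hdet_in (al :\ j :\ p) G)); first by rewrite unitq.
rewrite (key j p) // setD1C (key p j) // 1?eq_sym //.
by rewrite conjq_central ?(gram_real (IH1 pal)).
Qed.

End Step.

Lemma gram_minorP al : gram_minor al.
Proof.
have [k] := ubnP #|al|; elim: k al => // k IHk al /ltnSE le_al.
have IH be : (#|be| < #|al|)%N -> gram_minor be.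
  by move=> lt_be; apply: IHk; exact: leq_trans lt_be le_al.
have [->|al0] := eqVneq al finset.set0.
  split=> [l j|p j||j|/not_dependent_rows0 []|_]; rewrite ?inE //.
  - by rewrite hdet_in0 conjq1.
  - by rewrite hdet_in0 ltr01.
have [i ial Ei] := hdet_in_rdet G al0.
have Ej j : j \in al -> rdet_in al j G = hdet_in al G.
  by move=> jal; rewrite Ei; exact: step_rdet_eq.
split=> [|p j pal jal|||/(step_dependent IH ial)|/(step_independent IH ial)].
- exact: step_herm.
- by rewrite step_cramer // Ej.
- by rewrite Ei; exact: step_real.
- exact: Ej.
- by rewrite Ei.
- by rewrite Ei.
Qed.

End GramMinors.

(** * Cofactor sums, rank and least squares *)

Section CofactorSums.
Variables (R : realType) (m n : nat).
Local Notation H := (quat R).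
Variable A : 'M[H]_(m, n).
Let G := A *m conjtr A.
Implicit Types (al be : {set 'I_m}).

Definition cofactor_sum k : 'M[H]_m :=
  \matrix_(l, j) \sum_(al : {set 'I_m} | (#|al| == k) && (j \in al) && (l \in al))
    row_cofactor G al l j.

Definition minor_sum k : H := \sum_(al : {set 'I_m} | #|al| == k) hdet_in al G.

Lemma sum_setU1 (V : nmodType) (F : {set 'I_m} -> V) (P : pred {set 'I_m}) k p :
  \sum_(be : {set 'I_m} | (#|be| == k.+1) && P (be :\ p) && (p \in be)) F be =
  \sum_(al : {set 'I_m} | (#|al| == k) && P al && (p \notin al)) F (p |: al).
Proof.
rewrite (reindex_onto (fun al => p |: al) (fun be => be :\ p)) /=; last first.
  by move=> be /andP[_ pbe]; rewrite setD1K.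
apply: eq_bigl => al; rewrite setU11 andbT.
have [pal|pal] := boolP (p \in al).
  rewrite andbF; apply/negbTE/negP => /andP[_ /eqP/setP/(_ p)].
  by rewrite !inE eqxx pal.
by rewrite setU1K // eqxx cardsU1 pal add1n eqSS !andbT.
Qed.

Lemma mul_row_cofactor_sum (v : 'rV[H]_m) k j :
  (v *m cofactor_sum k) 0 j = \sum_(al : {set 'I_m} | (#|al| == k) && (j \in al))
    \sum_(l in al) v 0 l * row_cofactor G al l j.
Proof.
rewrite mxE [RHS](exchange_big_dep predT) //=; apply: eq_bigr => l _.
by rewrite mxE big_distrr.
Qed.

(** In entry [(p, j)], sets containing [p] obey Cramer's rule; for the others the inner sum is minus
    the cofactor [(p, j)] on [p |: al], by [row_cofactor_rec]. *)
Lemma cofactor_sum_rec k :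
  G *m cofactor_sum k = (minor_sum k)%:M - cofactor_sum k.+1.
Proof.
apply/matrixP => p j.
have -> : (G *m cofactor_sum k) p j = (row p G *m cofactor_sum k) 0 j.
  by rewrite -row_mul [RHS]mxE.
rewrite mul_row_cofactor_sum (bigID (fun al => p \in al)) /=.
have E1 : \sum_(al : {set 'I_m} | (#|al| == k) && (j \in al) && (p \in al))
    \sum_(l in al) row p G 0 l * row_cofactor G al l j =
    \sum_(al : {set 'I_m} | (#|al| == k) && (j \in al) && (p \in al))
    if p == j then hdet_in al G else 0.
  apply: eq_bigr => al /andP[/andP[_ jal] pal].
  rewrite -(gram_cramer (gram_minorP A al)) //.
  by apply: eq_bigr => l _; rewrite [row _ _ _ _]mxE.
have E2 : \sum_(al : {set 'I_m} | (#|al| == k) && (j \in al) && (p \notin al))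
    \sum_(l in al) row p G 0 l * row_cofactor G al l j =
    - \sum_(al : {set 'I_m} | (#|al| == k) && (j \in al) && (p \notin al))
    row_cofactor G (p |: al) p j.
  rewrite -sumrN; apply: eq_bigr => al /andP[/andP[_ jal] pal].
  rewrite row_cofactor_rec ?setU1K ?opprK //; last first.
  - by apply: contraNneq pal => ->.
  - by rewrite !inE jal orbT.
  by apply: eq_bigr => l _; rewrite [row _ _ _ _]mxE.
rewrite E1 E2 [RHS]mxE [X in _ = X + _]mxE [X in _ = _ + X]mxE [in RHS]mxE.
have [->|pj] := eqVneq p j; last first.
  rewrite mulr0n big1 //; congr (_ - _).
  rewrite -(sum_setU1 (fun be => row_cofactor G be p j) (fun al => j \in al)).
  apply: eq_bigl => be; congr (_ && _ && _).
  by rewrite !inE eq_sym pj.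
(* On the diagonal the second kind of set is absent, and entry [(j, j)] of [cofactor_sum k.+1]
   collects the minors of the [k]-sets that avoid [j]. *)
rewrite mulr1n [X in _ - X]big1 ?subr0; last first.
  by move=> al /andP[/andP[_ ->]].
rewrite /minor_sum [X in _ = X - _](bigID (fun al => j \in al)) /=.
have -> : \sum_(al : {set 'I_m} | (#|al| == k.+1) && (j \in al) && (j \in al))
    row_cofactor G al j j =
  \sum_(al : {set 'I_m} | (#|al| == k) && (j \notin al)) hdet_in al G.
  under eq_bigl do rewrite -andbA andbb -[_ == _]andbT.
  rewrite (sum_setU1 _ predT); apply: eq_big => [al|al]; first by rewrite andbT.
  by rewrite andbT => /andP[_ jal]; rewrite row_cofactor_diag setU1K.
by rewrite addrK; apply: eq_bigl => al; rewrite -andbA andbb.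
Qed.

Lemma conjtr_cofactor_sum k : conjtr (cofactor_sum k) = cofactor_sum k.
Proof.
apply/matrixP => l j; rewrite conjtrE !mxE conjq_sum.
apply: eq_big => [al|al /andP[/andP[_ lal] jal]]; first by rewrite andbAC.
by rewrite (gram_herm (gram_minorP A al)).
Qed.

Lemma conjtr_gram : conjtr G = G.
Proof. by rewrite conjtrM conjtrK. Qed.

Variable r : nat.
Hypothesis dep_gt : forall al, (r < #|al|)%N -> dependent_rows A al.

Lemma minor_sum_gt k : (r < k)%N -> minor_sum k = 0.
Proof.
move=> rk; apply: big1 => al /eqP alk.
by apply: (gram_dependent (gram_minorP A al)); apply: dep_gt; rewrite alk.
Qed.

(** Descending induction from [k > m], where no index set exists. Below, [minor_sum k = 0] makes
    [cofactor_sum k.+1] equal to [- G C_k], so [G G C_k = 0], and [G C_k = 0] because [G] is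
    Hermitian. *)
Lemma gram_cofactor_sum_gt k : (r < k)%N -> G *m cofactor_sum k = 0.
Proof.
have big k' : (m < k')%N -> cofactor_sum k' = 0.
  move=> mk; apply/matrixP => i j; rewrite !mxE big1 // => al.
  move=> /andP[/andP[/eqP alk _] _]; have := max_card (mem al).
  by rewrite alk card_ord leqNgt mk.
have [d] := ubnP (m.+1 - k); elim: d k => // d IHd k dk rk.
have [mk|km] := ltnP m k; first by rewrite big // mulmx0.
have : G *m cofactor_sum k.+1 = 0.
  apply: IHd (leqW rk); rewrite subSS.
  by rewrite subSn // ltnS in dk.
have := cofactor_sum_rec k; rewrite minor_sum_gt // raddf0 add0r => E.
rewrite -[cofactor_sum k.+1]opprK -E mulmxN => /eqP; rewrite oppr_eq0 => /eqP GG.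
by apply: conjtr_mulmx_eq0; rewrite conjtrM conjtr_gram -mulmxA GG mulmx0.
Qed.

Lemma cofactor_sum_annihilates : cofactor_sum r.+1 *m A = 0.
Proof.
have /gram_mul_eq0/(congr1 (@conjtr R _ _)) := gram_cofactor_sum_gt (ltnSn r).
by rewrite conjtrM conjtrK conjtr_cofactor_sum conjtr0.
Qed.

(** No minor is negative, and the one on [al] is positive. *)
Lemma minor_sum_gt0 al : #|al| = r -> ~ dependent_rows A al ->
  0 < qr (minor_sum r).
Proof.
move=> alr dal; rewrite qr_sum (bigD1 al) ?alr //=.
apply: ltr_pwDl; first exact: (gram_independent (gram_minorP A al)).
apply: sumr_ge0 => be _; have [dbe|dbe] := pselect (dependent_rows A be).
  by rewrite (gram_dependent (gram_minorP A be)).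
exact/ltW/(gram_independent (gram_minorP A be)).
Qed.

End CofactorSums.

(** * From column rank to independent rows *)

Section RankOfRows.
Variable R : realType.
Local Notation H := (quat R).

(** Gaussian elimination over the skew field, by induction on the number of equations. *)
Lemma exists_kernel_vector p m (N : 'M[H]_(p, m)) (al : {set 'I_m}) :
  (p < #|al|)%N -> exists x : 'cV[H]_m,
    [/\ x != 0, forall i, i \notin al -> x i 0 = 0 & N *m x = 0].
Proof.
elim: p N al => [|p IH] N al.
  case/card_gt0P => k kal; exists (delta_mx k 0); split.
  - by apply/eqP => /matrixP/(_ k 0)/eqP; rewrite !mxE !eqxx oner_eq0.
  - move=> i ial; rewrite mxE andbT; case: eqP ial => [->|//].
    by rewrite kal.
  - by apply/matrixP => -[].
(* Either the first equation is trivial on [al] and is dropped, or some [k0] in [al] serves as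
   pivot. *)
move=> pal; case: (pickP [pred k | (k \in al) && (N 0 k != 0)]) => [k0|N0]; last first.
  have [|x [x0 xal Nx]] := IH (\matrix_(i, k) N (lift 0 i) k) al.
    exact: ltnW.
  exists x; split=> //; apply/colP => i; rewrite [RHS]mxE.
  case: (unliftP 0 i) => [i'|] ->.
    have /colP/(_ i') := Nx; rewrite !mxE; apply: etrans.
    by apply: eq_bigr => k _; rewrite mxE.
  rewrite mxE big1 // => k _; have := N0 k; rewrite inE.
  by case: (boolP (k \in al)) => [_ /negbFE/eqP->|/xal->]; rewrite ?mul0r ?mulr0.
move=> /andP[k0al u0].
have [|x [x0 xal Nx]] := IH
  (\matrix_(i, k) (N (lift 0 i) k - N (lift 0 i) k0 * (N 0 k0)^-1 * N 0 k)) (al :\ k0).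
  by move: pal; rewrite (cardsD1 k0) k0al.
(* The value [c] of the unknown [k0] solves the first equation; coefficients act on the left, so the
   inverse is applied there. *)
pose S := \sum_k N 0 k * x k 0; pose c := - ((N 0 k0)^-1 * S).
have xk0 : x k0 0 = 0 by rewrite xal // !inE eqxx.
have Ny i : (N *m (x + \col_k (if k == k0 then c else 0))) i 0 =
    \sum_k N i k * x k 0 + N i k0 * c.
  rewrite mulmxDr mxE; congr (_ + _); rewrite mxE // (bigD1 k0) //= mxE eqxx.
  by rewrite big1 ?addr0 // => k /negPf kk0; rewrite mxE kk0 mulr0.
exists (x + \col_k (if k == k0 then c else 0)); split.
- apply: contra_neq x0 => y0; apply/colP => k; have /colP/(_ k) := y0.
  by rewrite !mxE; case: eqP => [->|]; rewrite ?xk0 ?addr0.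
- move=> i ial; rewrite !mxE; case: eqP => [ik|_].
    by rewrite ik k0al in ial.
  by rewrite addr0 xal // !inE (negPf ial) andbF.
apply/colP => i; rewrite Ny [RHS]mxE /c mulrN; case: (unliftP 0 i) => [i'|] ->.
  have /colP/(_ i') := Nx; rewrite !mxE; apply: etrans.
  rewrite mulrA /S big_distrr -sumrB; apply: eq_bigr => k _ /=.
  by rewrite mxE mulrBl !mulrA.
by rewrite mulrA mulrV ?unitq // mul1r subrr.
Qed.

Lemma mulmx_factor m n p (A : 'M[H]_(m, n)) (C : 'M[H]_(m, p)) :
  (right_colspace A `<=` right_colspace C)%classic -> exists F, A = C *m F.
Proof.
move=> AC; have /choice[f Hf] : forall j, exists x, C *m x = col j A.
  move=> j; have [|x _ Ex] := AC (col j A); last by exists x.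
  by exists (delta_mx j 0); rewrite // colE.
exists (\matrix_(k, j) f j k 0); apply/matrixP => i j.
have /colP/(_ i) := Hf j; rewrite !mxE => <-.
by apply: eq_bigr => k _; rewrite mxE.
Qed.

Variables (m n : nat) (A : 'M[H]_(m, n)) (r : nat).
Hypothesis rA : has_rank A r.

(** Equal column spaces make [A] and [C] right multiples of each other, so the row relations of [A]
    are those of a matrix with only [r] columns. *)
Lemma rank_factorization : exists C : 'M[H]_(m, r), right_free C /\
  forall x : 'cV[H]_m, conjtr A *m x = 0 <-> conjtr C *m x = 0.
Proof.
have [C fC EC] := rA; exists C; split=> //.
have [F EA] : exists F, A = C *m F by apply: mulmx_factor; rewrite EC.
have [K EK] : exists K, C = A *m K by apply: mulmx_factor; rewrite EC.
move=> x; split=> [Ax|Cx].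
  by rewrite EK conjtrM -mulmxA Ax mulmx0.
by rewrite EA conjtrM -mulmxA Cx mulmx0.
Qed.

Lemma dependent_rows_gt (al : {set 'I_m}) : (r < #|al|)%N -> dependent_rows A al.
Proof.
have [C [_ AC]] := rank_factorization.
move=> /(exists_kernel_vector (conjtr C))[x [x0 xal Cx]].
by exists x; split=> //; apply/AC.
Qed.

(** A maximal independent [al] works: if it had fewer than [r] elements, some nonzero [y] would be
    annihilated by the rows of [C] in [al], hence by all rows of [C], against [right_free C]. *)
Lemma exists_independent_rows : exists al : {set 'I_m},
  #|al| = r /\ ~ dependent_rows A al.
Proof.
have [C [fC AC]] := rank_factorization.
pose P (al : {set 'I_m}) := `[< ~ dependent_rows A al >].
have P0 : P finset.set0 by apply/asboolP; exact: not_dependent_rows0.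
case: (arg_maxnP (fun al : {set 'I_m} => #|al|) P0) => al /asboolP Pal maxal.
exists al; split=> //; apply/eqP; rewrite eqn_leq; apply/andP; split.
  by rewrite leqNgt; apply/negP => /dependent_rows_gt.
rewrite leqNgt; apply/negP => lt_al.
have [|y [y0 _ Cy]] := @exists_kernel_vector _ _
    (\matrix_(i < #|al|, k < r) C (enum_val i) k) finset.setT.
  by rewrite cardsT card_ord.
suff Cy0 : C *m y = 0 by rewrite (fC _ Cy0) eqxx in y0.
have Cyal i : i \in al -> (C *m y) i 0 = 0.
  move=> ial; have /colP/(_ (enum_rank_in ial i)) := Cy; rewrite !mxE; apply: etrans.
  by apply: eq_bigr => k _; rewrite mxE enum_rankK_in.
apply/colP => i; rewrite [RHS]mxE; have [/Cyal//|ial] := boolP (i \in al).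
have [x [x0 xal /AC Cx]] : dependent_rows A (i |: al).
  apply: contrapT => Pi; have := maxal (i |: al).
  by rewrite cardsU1 ial /= ltnn => /(_ (introT (asboolP _) Pi)).
have xi : x i 0 != 0.
  apply/eqP => xi; apply: Pal; exists x; split=> //; last exact/AC.
  move=> k kal; have [->//|ki] := eqVneq k i.
  by rewrite xal // !inE negb_or ki.
(* In [x^* C y = 0] only the term at [i] survives, and [x i 0] is nonzero by independence of
   [al]. *)
have /(congr1 (fun Z : 'M[H]_(1, 1) => Z 0 0)) : conjtr x *m (C *m y) = 0.
  by rewrite mulmxA -[conjtr x *m C]conjtrK conjtrM conjtrK Cx conjtr0 mul0mx.
rewrite [X in X = _ -> _]mxE [X in _ = X -> _]mxE.
rewrite (bigD1 i) //= big1 ?addr0 => [/eqP|k ki].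
  rewrite mulq_eq0 conjtrE => /orP[/eqP/(congr1 (@conjq R))|/eqP//].
  by rewrite conjqK conjq0 => xi0; rewrite xi0 eqxx in xi.
have [/Cyal->|kal] := boolP (k \in al); first by rewrite mulr0.
by rewrite conjtrE xal ?conjq0 ?mul0r // !inE negb_or ki.
Qed.

End RankOfRows.

(** * Orthogonality conditions for least squares *)

Section LeastSquares.
Variable R : realType.
Local Notation H := (quat R).

Definition frob_dot s m (X Y : 'M[H]_(s, m)) : R := qr (\tr (X *m conjtr Y)).

Lemma frob_dotE s m (X Y : 'M[H]_(s, m)) :
  frob_dot X Y = \sum_i \sum_j qr (X i j * conjq (Y i j)).
Proof.
rewrite /frob_dot /mxtrace qr_sum; apply: eq_bigr => i _.
by rewrite mxE qr_sum; apply: eq_bigr => j _; rewrite conjtrE.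
Qed.

Lemma frob_dot_adjoint s m n (X : 'M[H]_(s, m)) (Y : 'M[H]_(s, n)) N :
  frob_dot X (Y *m N) = frob_dot (X *m conjtr N) Y.
Proof. by rewrite /frob_dot conjtrM mulmxA. Qed.

Lemma frob_dot_ge0 s m (X : 'M[H]_(s, m)) : 0 <= frob_dot X X.
Proof.
rewrite frob_dotE; do 2 apply: sumr_ge0 => ? _.
by rewrite qr_conjMr normq2_ge0.
Qed.

Lemma frob_dot_eq0 s m (X : 'M[H]_(s, m)) : frob_dot X X = 0 -> X = 0.
Proof.
rewrite frob_dotE => /eqP; have ge0 i j : 0 <= qr (X i j * conjq (X i j)).
  by rewrite qr_conjMr normq2_ge0.
rewrite psumr_eq0 => [/allP X0|i _]; last exact: sumr_ge0.
apply/matrixP => i j; rewrite mxE; apply/eqP; rewrite -normq2_eq0 -qr_conjMr.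
have := X0 i; rewrite mem_index_enum => /(_ isT).
by rewrite psumr_eq0 // => /allP/(_ j); rewrite mem_index_enum => /(_ isT).
Qed.

Lemma ler_frob s m n p (X : 'M[H]_(s, m)) (Y : 'M[H]_(n, p)) :
  (frob X <= frob Y) = (frob_dot X X <= frob_dot Y Y).
Proof.
have E a b (Z : 'M[H]_(a, b)) : \sum_i \sum_j normq2 (Z i j) = frob_dot Z Z.
  rewrite frob_dotE; do 2 apply: eq_bigr => ? _.
  by rewrite qr_conjMr.
by rewrite /frob !E ler_sqrt // frob_dot_ge0.
Qed.

Lemma frob_dot_perturb s m (X E : 'M[H]_(s, m)) (t : R) :
  frob_dot (X + Quat t 0 0 0 *: E) (X + Quat t 0 0 0 *: E) =
  frob_dot X X + 2 * t * frob_dot X E + t ^+ 2 * frob_dot E E.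
Proof.
rewrite !frob_dotE !big_distrr -!big_split /=; apply: eq_bigr => i _.
rewrite !big_distrr -!big_split /=; apply: eq_bigr => j _; rewrite !mxE.
case: (X i j) (E i j) => [a b c d] [a' b' c' d'] /=; ring.
Qed.

(** First-order condition: the quadratic [2 t b + t^2 c] is nonnegative for every real [t], which
    forces [b = 0]. *)
Lemma frob_dot_minimal s m (X E : 'M[H]_(s, m)) :
  (forall t : R, frob X <= frob (X + Quat t 0 0 0 *: E)) -> frob_dot X E = 0.
Proof.
move=> minX; set b := frob_dot X E; set c := frob_dot E E.
have c0 : 0 <= c by exact: frob_dot_ge0.
have c1 : c + 1 != 0 by apply/lt0r_neq0/ltr_wpDl.
(* Dividing by [c + 1] instead of [c] also covers [c = 0]. *)
have := minX (- b / (c + 1)); rewrite ler_frob frob_dot_perturb -/b -/c -addrA lerDl.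
have -> : 2 * (- b / (c + 1)) * b + (- b / (c + 1)) ^+ 2 * c =
    - ((c + 2) / (c + 1) ^+ 2 * b ^+ 2) by field.
rewrite oppr_ge0 pmulr_rle0; last by rewrite divr_gt0 ?exprn_gt0 ?ltr_wpDl.
by move=> b2; apply/eqP; rewrite -sqrf_eq0 eq_le b2 sqr_ge0.
Qed.

Variables (s m n : nat) (A : 'M[H]_(m, n)) (B : 'M[H]_(s, n)) (X : 'M[H]_(s, m)).

(** With [Z = X A - B], moving [X] in the direction [Z A^*] shows that [Z] is orthogonal to
    [Z A^* A], which says that [Z A^*] has norm zero. *)
Lemma least_squares_normal_equation :
  least_squares A B X -> X *m (A *m conjtr A) = B *m conjtr A.
Proof.
move=> lsX; apply/eqP; rewrite mulmxA -subr_eq0 -mulmxBl; apply/eqP.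
apply: frob_dot_eq0; rewrite -frob_dot_adjoint; apply: frob_dot_minimal => t.
have := lsX (X + Quat t 0 0 0 *: ((X *m A - B) *m conjtr A)).
by rewrite (mulmxDl X) -scalemxAl addrAC.
Qed.

Lemma min_norm_orthogonal (E : 'M[H]_(s, m)) :
  min_norm_least_squares A B X -> E *m A = 0 -> frob_dot X E = 0.
Proof.
move=> [lsX minX] EA; apply: frob_dot_minimal => t; apply: minX => Y.
by rewrite (mulmxDl X) -scalemxAl EA scaler0 addr0; exact: lsX.
Qed.

(** As [C] is Hermitian, the squared norm of [X C] is the product of [X] with [X C C], a direction
    annihilated by [A]. *)
Lemma min_norm_annihilated (C : 'M[H]_m) :
  min_norm_least_squares A B X -> conjtr C = C -> C *m A = 0 -> X *m C = 0.
Proof.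
move=> hX hC CA; apply: frob_dot_eq0; rewrite -{1}hC -frob_dot_adjoint.
by apply: min_norm_orthogonal => //; rewrite -!mulmxA CA !mulmx0.
Qed.

Lemma cramer_min_norm r : min_norm_least_squares A B X -> has_rank A r ->
  forall i j, X i j =
    (\sum_(al : {set 'I_m} | (#|al| == r) && (j \in al))
       rdet_in al j (set_row j (row i (B *m conjtr A)) (A *m conjtr A))) /
    (\sum_(al : {set 'I_m} | #|al| == r) hdet_in al (A *m conjtr A)).
Proof.
move=> hX rA i j; rewrite -/(minor_sum A r).
have dep := dependent_rows_gt rA.
have [al [alr ind]] := exists_independent_rows rA.
have Dr0 : minor_sum A r != 0.
  by apply: contraTneq (minor_sum_gt0 alr ind) => ->; rewrite ltxx.
apply: (mulIr (x := minor_sum A r)); rewrite ?unitq // divrK ?unitq //.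
have XC : X *m cofactor_sum A r.+1 = 0.
  apply: min_norm_annihilated hX _ _; first exact: conjtr_cofactor_sum.
  exact: cofactor_sum_annihilates.
transitivity ((X *m (minor_sum A r)%:M) i j).
  rewrite mxE (bigD1 j) //= mxE eqxx mulr1n big1 ?addr0 // => k kj.
  by rewrite mxE (negPf kj) mulr0n mulr0.
(* Here [D_r] becomes [G C_r + C_(r+1)]; [X] kills the second term and the normal equation rewrites
   [X G]. *)
rewrite -[_%:M](subrK (cofactor_sum A r.+1)) -cofactor_sum_rec.
rewrite mulmxDr XC addr0 mulmxA (least_squares_normal_equation hX.1).
transitivity ((row i (B *m conjtr A) *m cofactor_sum A r) 0 j).
  by rewrite -row_mul [RHS]mxE.
rewrite mul_row_cofactor_sum; apply: eq_bigr => be /andP[_ jbe].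
by rewrite rdet_in_expand.
Qed.

End LeastSquares.

Theorem theorem4p4 (R : realType) (m n s : nat)
    (A : 'M[quat R]_(m, n)) (B : 'M[quat R]_(s, n)) (X : 'M[quat R]_(s, m))
    (hX : min_norm_least_squares A B X) :
  let G := A *m conjtr A in
  let Bc := B *m conjtr A in
  (forall r : nat, (1 <= r)%N -> has_rank A r -> (r <= n)%N -> (n < m)%N ->
     forall (i : 'I_s) (j : 'I_m),
       X i j =
         (\sum_(alpha : {set 'I_m} | (#|alpha| == r) && (j \in alpha))
             rdet_in alpha j (set_row j (row i Bc) G)) /
         (\sum_(alpha : {set 'I_m} | #|alpha| == r) hdet_in alpha G)) /\
  (has_rank A m ->
     forall (i : 'I_s) (j : 'I_m),
       X i j = rdet j (set_row j (row i Bc) G) / hdet G).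
Proof.
split=> [r _ rA _ _ i j|rA i j]; first exact: cramer_min_norm.
(* For rank [m] the full set is the only index set, so both sums have one term. *)
have cardT (al : {set 'I_m}) : (#|al| == m) = (al == finset.setT).
  rewrite eqEcard finset.subsetT cardsT card_ord eqn_leq.
  by have := max_card (mem al); rewrite card_ord => ->.
rewrite (cramer_min_norm hX rA); congr (_ / _); apply: big_pred1 => al /=.
  by rewrite cardT; case: eqP => // ->; rewrite finset.inE.
exact: cardT.
Qed.
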